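(* For every $4\times 4$ complex positive semidefinite matrix $A$, $$[\mathrm{per}(A)]^2\geq \mathrm{per}(A\circ \bar{A}).$$
   Context: Positive semidefinite matrices are complex Hermitian matrices $A$ with $v^*Av\ge 0$ for all complex vectors $v$. For an $n\times n$ matrix $A=(A_{ij})$, $\mathrm{per}(A)=\sum_{\sigma\in S_n}\prod_{i=1}^n A_{i\sigma(i)}$ denotes the permanent (which is a nonnegative real number when $A$ is positive semidefinite), $\bar{A}=(\overline{A_{ij}})$ denotes the entrywise complex conjugate of $A$, and $A\circ B=(A_{ij}B_{ij})$ denotes the Hadamard (entrywise) product of $A$ and $B$. *)

(* Defs.v *)
From mathcomp Require Import all_boot all_order all_algebra all_fingroup.
From mathcomp Require Import sesquilinear spectral.

Set Implicit Arguments.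
Unset Strict Implicit.
Unset Printing Implicit Defensive.

Import Order.TTheory GRing.Theory Num.Theory.
Local Open Scope ring_scope.
Local Open Scope sesquilinear_scope.

Definition permanent (C : comNzRingType) (n : nat) (A : 'M[C]_n) : C :=
  \sum_(s : 'S_n) \prod_(i < n) A i (s i).

Definition hadamard (C : comNzRingType) (m n : nat) (A B : 'M[C]_(m, n)) :
  'M[C]_(m, n) := map2_mx *%R A B.

Definition entrywise_conj (C : numClosedFieldType) (m n : nat) (A : 'M[C]_(m, n)) :
  'M[C]_(m, n) := map_mx Num.conj A.

(* In a numClosedFieldType, [0 <= z] says that z is real and nonnegative. *)
Definition psdmx (C : numClosedFieldType) (n : nat) (A : 'M[C]_n) : Prop :=
  A \is hermsymmx /\ forall v : 'cV[C]_n, 0 <= (v^t* *m A *m v) 0 0.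

(* [hermsymmx] read entrywise. *)
Lemma hermsymmxE (C : numClosedFieldType) (n : nat) (A : 'M[C]_n) :
  A \is hermsymmx <-> forall i j, A i j = Num.conj (A j i).
Proof.
split=> [/is_hermitianmxP hA i j | hA].
  by rewrite {1}hA expr0 scale1r !mxE.
apply/is_hermitianmxP; rewrite expr0 scale1r.
by apply/matrixP=> i j; rewrite !mxE -hA.
Qed.

(* Main.v *)
Require Import Defs.
From mathcomp Require Import all_boot all_order all_algebra all_fingroup.
From mathcomp Require Import reals.
From mathcomp Require Import complex.
From mathcomp Require Import sesquilinear spectral ring lra.
Import Order.TTheory GRing.Theory Num.Theory.
Local Open Scope ring_scope.
Local Open Scope sesquilinear_scope.

Set Implicit Arguments.
Unset Strict Implicit.
Unset Printing Implicit Defensive.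

(** If some diagonal entry of A vanishes, so does its row, and both permanents
    are 0. Otherwise dividing A i j by the square roots of A i i and A j j
    divides both sides of the inequality by the same positive number, so A may
    be taken to have unit diagonal.

    Let x_ij = |A i j|^2. The permanent of A o conj A depends on the x_ij alone,
    while P = per A also depends on the phases. It is therefore enough to bound
    P below by quantities in the x_ij. Each perfect matching {ij, kl} of the
    indices has a sum p = x_ij + x_kl and a product r = x_ij x_kl. Two kinds of
    bounds carry the proof.

    - The inequality of Lieb, P >= (1 + x_ij) (1 + x_kl) = 1 + p + r, for each
      of the three matchings (permanent_entries_ge_matching01_23 and its two
      relabellings). It is strong when the x_ij are small.
    - P >= 3 (p1 + p2 + p3) - 3 - (r1 + r2 + r3), which comes from the
      nonnegativity of the four principal 3 x 3 minors
      (permanent_entries_ge_triangles). It is strong when the x_ij are large,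
      because then the phases around each triangle are nearly aligned.

    What is left is a real inequality on the cube [0, 1]^6 (modulus_permanent_le).
    The target is an equality only for the identity matrix, so it has room for
    crude estimates: with p1 the largest of the three sums, the first bound for
    that matching suffices if p2 + p3 <= 6/5 (matching_bound_suffices) and the
    second one suffices if p2 + p3 >= 6/5 (minors_bound_suffices). *)

(** * Permanents *)

(** The permutations sending 0 to j are the lift_perm 0 j s, with s a permutation
    of the remaining indices. *)
Lemma permanent_expand_row0 (K : comNzRingType) (n : nat) (A : 'M[K]_n.+1) :
  permanent A = \sum_j A ord0 j * permanent (row' ord0 (col' j A)).
Proof.
rewrite /permanent (partition_big (fun s : 'S_n.+1 => s ord0) predT) //=.
apply: eq_bigr => j _; rewrite big_distrr /=.
rewrite (reindex (lift_perm ord0 j)); last first.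
  pose ulsf i (s : 'S_n.+1) k := odflt k (unlift (s i) (s (lift i k))).
  have ulsfK i (s : 'S_n.+1) k : lift (s i) (ulsf i s k) = s (lift i k).
    rewrite /ulsf; have:= neq_lift i k.
    by rewrite -(can_eq (permK s)) => /unlift_some[] ? ? ->.
  have inj_ulsf : injective (ulsf ord0 _).
    by move=> s; apply: can_inj (ulsf (s ord0) s^-1%g) _ => k'; rewrite {1}/ulsf ulsfK !permK liftK.
  exists (fun s => perm (inj_ulsf s)) => [s _ | s].
    by apply/permP => k'; rewrite permE /ulsf lift_perm_lift lift_perm_id liftK.
  move/(s _ =P _) => si0; apply/permP=> k.
  case: (unliftP ord0 k) => [k'|] ->; rewrite ?lift_perm_id //.
  by rewrite lift_perm_lift -si0 permE ulsfK.
apply: eq_big => [s|s _]; first by rewrite lift_perm_id eqxx.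
rewrite big_ord_recl lift_perm_id; congr (_ * _).
by apply: eq_bigr => i _; rewrite lift_perm_lift !mxE.
Qed.

Lemma permanent0 (K : comNzRingType) (A : 'M[K]_0) : permanent A = 1.
Proof.
rewrite /permanent (eq_bigr (fun=> 1)) => [|s _]; last by rewrite big_ord0.
by rewrite sumr_const card_Sn.
Qed.

Lemma permanent_zero_row (K : comNzRingType) (n : nat) (A : 'M[K]_n) (i : 'I_n) :
  (forall j, A i j = 0) -> permanent A = 0.
Proof.
move=> A0; rewrite /permanent big1 // => s _.
by rewrite (bigD1 i) //= A0 mul0r.
Qed.

Lemma permanent_scale (K : comNzRingType) (n : nat) (s t : 'I_n -> K) (A : 'M[K]_n) :
  permanent (\matrix_(i, j) (s i * A i j * t j)) =
  (\prod_i s i) * (\prod_i t i) * permanent A.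
Proof.
rewrite /permanent big_distrr; apply: eq_bigr => /= u _.
rewrite [\prod_i t i](reindex_inj (@perm_inj _ u)) /= -!big_split /=.
by apply: eq_bigr => i _; rewrite mxE mulrAC.
Qed.

(** Indexing entries by natural numbers keeps every iterated minor of this same
    form, so that expanding row after row reduces to explicit entries. *)
Definition nat_permanent (K : comNzRingType) (n : nat) (g : nat -> nat -> K) : K :=
  permanent (\matrix_(i < n, j < n) g i j).

Lemma nat_permanentS (K : comNzRingType) (n : nat) (g : nat -> nat -> K) :
  nat_permanent n.+1 g =
  \sum_(j < n.+1) g 0 j * nat_permanent n (fun i k => g i.+1 (bump j k)).
Proof.
rewrite /nat_permanent permanent_expand_row0; apply: eq_bigr => j _.
by rewrite mxE; congr (_ * permanent _); apply/matrixP => i k; rewrite !mxE.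
Qed.

(** The permanent of a Hermitian 4 x 4 matrix A with unit diagonal, in terms of
    a = A 0 1, b = A 2 3, c = A 0 2, d = A 1 3, e = A 0 3 and f = A 1 2: the
    pairs (a, b), (c, d), (e, f) are the three perfect matchings. The successive
    terms come from the identity, the transpositions, the 3-cycles on each of
    the four triples, the double transpositions, and the 4-cycles. *)
Definition permanent_entries (C : numClosedFieldType) (a b c d e f : C) : C :=
  1 + (a * a^* + b * b^* + c * c^* + d * d^* + e * e^* + f * f^*)
  + (a * f * c^* + a^* * f^* * c) + (a * d * e^* + a^* * d^* * e)
  + (c * b * e^* + c^* * b^* * e) + (f * b * d^* + f^* * b^* * d)
  + (a * a^* * (b * b^*) + c * c^* * (d * d^*) + e * e^* * (f * f^*))
  + (c * d * (e * f)^* + (c * d)^* * (e * f))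
  + (a * b * (e * f^*)^* + (a * b)^* * (e * f^*))
  + (a * b^* * (c * d^*)^* + (a * b^*)^* * (c * d^*)).

Local Notation o0 := (@Ordinal 4 0 isT).
Local Notation o1 := (@Ordinal 4 1 isT).
Local Notation o2 := (@Ordinal 4 2 isT).
Local Notation o3 := (@Ordinal 4 3 isT).

Lemma permanent_correlation4 (C : numClosedFieldType) (A : 'M[C]_4) :
  (forall i j, A i j = (A j i)^*) -> (forall i, A i i = 1) ->
  permanent A = permanent_entries (A o0 o1) (A o2 o3) (A o0 o2) (A o1 o3) (A o0 o3) (A o1 o2).
Proof.
move=> hA A1.
pose g m n := A (inord m) (inord n).
have gE (i j : 'I_4) : A i j = g i j by rewrite /g !inord_val.
have g1 m : g m m = 1 by apply: A1.
have gC m n : g m n = (g n m)^* by apply: hA.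
have -> : permanent A = nat_permanent 4 g.
  by congr permanent; apply/matrixP => i j; rewrite mxE.
do 4![rewrite !nat_permanentS !big_ord_recl !big_ord0 /=].
rewrite /nat_permanent !permanent0 /bump /= ?addn0 ?add0n ?addn1 ?add1n !g1.
rewrite /permanent_entries !gE /=.
rewrite (gC 1 0) (gC 2 0) (gC 3 0) (gC 2 1) (gC 3 1) (gC 3 2)%N.
rewrite !rmorphM /= !conjCK.
ring.
Qed.

(** * Positive semidefinite matrices *)

(** The quadratic form of A at the vector u e_i + v e_j + w e_k. The indices may
    coincide, so this covers vectors with smaller support. *)
Lemma psdmx_form3 (C : numClosedFieldType) (n : nat) (A : 'M[C]_n) (i j k : 'I_n) (u v w : C) :
  psdmx A ->
  0 <= u^* * u * A i i + v^* * v * A j j + w^* * w * A k k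
     + (u^* * v * A i j + v^* * u * A j i)
     + (u^* * w * A i k + w^* * u * A k i)
     + (v^* * w * A j k + w^* * v * A k j).
Proof.
case=> _ /(_ (u *: delta_mx i 0 + v *: delta_mx j 0 + w *: delta_mx k 0)).
have dE p q : (delta_mx 0 p *m A *m delta_mx q (0 : 'I_1)) (0 : 'I_1) 0 = A p q.
  by rewrite -rowE -colE !mxE.
rewrite !linearD !linearZ /= !map_mxD !map_mxZ !trmx_delta !map_delta_mx /=.
rewrite !mulmxDl -!scalemxAl.
rewrite [X in 0 <= X](_ : _ =
  u * (u^* * A i i + v^* * A j i + w^* * A k i)
  + v * (u^* * A i j + v^* * A j j + w^* * A k j)
  + w * (u^* * A i k + v^* * A j k + w^* * A k k)); last first.
  have zE (x : C) (B : 'M[C]_1) : (x *: B) 0 0 = x * B 0 0 by rewrite mxE.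
  have addE (B D : 'M[C]_1) : (B + D) 0 0 = B 0 0 + D 0 0 by rewrite mxE.
  by rewrite !(addE, zE, dE).
by congr (0 <= _); ring.
Qed.

Section Correlation.
Variables (C : numClosedFieldType) (n : nat) (A : 'M[C]_n).
Hypotheses (hA : psdmx A) (A1 : forall i, A i i = 1).

Let Ac i j : A i j = (A j i)^*.
Proof. by case: hA => /hermsymmxE h _; apply: h. Qed.

Lemma correlation_sqnorm_le1 i j : A i j * (A i j)^* <= 1.
Proof.
have := psdmx_form3 i j j (- A i j) 1 0 hA.
rewrite !A1 (Ac j i) !rmorphN rmorph0 rmorph1 => h.
rewrite -subr_ge0.
by move: h; congr (0 <= _); ring.
Qed.

(** Write a = A i j, b = A j k, c = A i k and delta = 1 - |a|^2. The principal
    minor is D = delta - E with E = |c - a b|^2 + delta |b|^2 >= 0. The vector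
    (t (a b - c), t (a^* c - b), 1), whose first two entries are t times
    cofactors, gives the form the value delta E t^2 - 2 E t + 1 when t is real.
    If E is not 0, then t = 1 / E gives delta / E >= 1, that is D >= 0, even when
    delta = 0, where the cofactor vector itself says nothing. *)
Lemma correlation_minor3_ge0 i j k :
  0 <= 1 + (A i j * A j k * (A i k)^* + (A i j)^* * (A j k)^* * A i k)
     - A i j * (A i j)^* - A j k * (A j k)^* - A i k * (A i k)^*.
Proof.
have hij := correlation_sqnorm_le1 i j; move: hij; rewrite -subr_ge0 => hij.
have form u v w := psdmx_form3 i j k u v w hA.
move: form hij; rewrite !A1 (Ac j i) (Ac k i) (Ac k j).
move: (A i j) (A j k) (A i k) => a b c form hij.
pose E := (c - a * b) * (c - a * b)^* + (1 - a * a^*) * (b * b^*).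
have E0 : 0 <= E by rewrite addr_ge0 ?mul_conjC_ge0 // mulr_ge0 ?mul_conjC_ge0.
have -> : 1 + (a * b * c^* + a^* * b^* * c) - a * a^* - b * b^* - c * c^* = 1 - a * a^* - E.
  by rewrite /E rmorphB rmorphM; ring.
have [->|En0] := eqVneq E 0; first by rewrite subr0.
have [t Et tC] : exists2 t, E * t = 1 & t^* = t.
  by exists E^-1; [rewrite divff | apply: conj_Creal; rewrite rpredV ger0_real].
have := form (t * (a * b - c)) (t * (a^* * c - b)) 1.
rewrite !(rmorphM, rmorphB) /= !conjCK rmorph1 tC => {}form.
have formE : 0 <= (1 - a * a^*) * t * (E * t) - (E * t) *+ 2 + 1.
  by move: form; congr (0 <= _); rewrite /E !(rmorphM, rmorphB) /=; ring.
have -> : 1 - a * a^* - E = E * ((1 - a * a^*) * t * (E * t) - (E * t) *+ 2 + 1).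
  transitivity ((1 - a * a^*) * (E * t) ^+ 2 - E * ((E * t) *+ 2 - 1)); last by ring.
  by rewrite Et; ring.
exact: mulr_ge0.
Qed.
End Correlation.

(** With m = |A i j|^2, the vector - A i j (A j j + 1) e_i + m e_j gives the form
    the value - m^2 (A j j + 2), which is negative unless m = 0. *)
Lemma psdmx_zero_row (C : numClosedFieldType) (n : nat) (A : 'M[C]_n) (i : 'I_n) :
  psdmx A -> A i i = 0 -> forall j, A i j = 0.
Proof.
move=> hA Ai0 j.
have Ac p q : A p q = (A q p)^* by case: hA => /hermsymmxE h _; apply: h.
have Aj0 : 0 <= A j j.
  by have := psdmx_form3 j j j 1 0 0 hA; rewrite rmorph1 rmorph0; congr (0 <= _); ring.
pose m := A i j * (A i j)^*.
have m0 : 0 <= m by apply: mul_conjC_ge0.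
have mC : m^* = m by apply: conj_Creal; apply: ger0_real.
have AjC : (A j j)^* = A j j by rewrite -Ac.
have := psdmx_form3 i j j (- A i j * (A j j + 1)) m 0 hA.
rewrite Ai0 (Ac j i) mC !rmorphM rmorphN rmorphD rmorph1 rmorph0 /= AjC => form.
have : 0 <= - (m ^+ 2 * (A j j + 2)).
  by move: form; congr (0 <= _); rewrite /m; ring.
rewrite oppr_ge0 pmulr_lle0 ?ltr_wpDl ?ltr0n // => m2.
have /eqP : m ^+ 2 == 0 by rewrite eq_le m2 exprn_ge0.
by move/eqP; rewrite sqrf_eq0 mul_conjC_eq0 => /eqP.
Qed.

Lemma psdmx_scale (C : numClosedFieldType) (n : nat) (A : 'M[C]_n) (s : 'I_n -> C) :
  (forall i, (s i)^* = s i) -> psdmx A -> psdmx (\matrix_(i, j) (s i * A i j * s j)).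
Proof.
move=> sC [/hermsymmxE hA posA]; split.
  by apply/hermsymmxE => i j; rewrite !mxE !rmorphM /= !sC -hA; ring.
move=> v; set D : 'M[C]_n := diag_mx (\row_i s i).
have -> : \matrix_(i, j) (s i * A i j * s j) = D *m A *m D.
  by apply/matrixP => i j; rewrite mul_mx_diag mul_diag_mx !mxE.
have DC : D^t* = D.
  by apply/matrixP => i j; rewrite !mxE eq_sym; case: eqP => [->|]; rewrite ?mulr1n ?mulr0n ?rmorph0 // sC.
by rewrite !mulmxA; have := posA (D *m v); rewrite trmx_mul map_mxM DC !mulmxA.
Qed.

(** * Lower bounds for the permanent of a correlation matrix *)

(** Lieb's inequality for the blocks {0, 1} and {2, 3}. Apart from the square
    |c d + e f|^2, the difference of the two sides is a Hermitian form in
    (c, d, e, f) whose matrix is the tensor product of the two 2 x 2 blocks, up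
    to conjugation. Completing the square first in the block of a, then in the
    block of b, writes it as a sum of squares. *)
Lemma permanent_entries_ge_matching01_23 (C : numClosedFieldType) (a b c d e f : C) :
  a * a^* <= 1 -> b * b^* <= 1 ->
  (1 + a * a^*) * (1 + b * b^*) <= permanent_entries a b c d e f.
Proof.
rewrite -[a * _ <= 1]subr_ge0 -[b * _ <= 1]subr_ge0 => ha hb.
rewrite -subr_ge0.
pose p := e + a * d; pose q := c + a * f.
have -> : permanent_entries a b c d e f - (1 + a * a^*) * (1 + b * b^*) =
  (p + b * q) * (p + b * q)^* + (1 - b * b^*) * (q * q^*)
  + (1 - a * a^*) * ((d + b * f) * (d + b * f)^* + (1 - b * b^*) * (f * f^*))
  + (c * d + e * f) * (c * d + e * f)^*.
  by rewrite /permanent_entries /p /q !(rmorphD, rmorphM) /= ?conjCK; ring.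
by repeat first [assumption | exact: mul_conjC_ge0 | apply: addr_ge0 | apply: mulr_ge0].
Qed.

Lemma permanent_entries_ge_matching02_13 (C : numClosedFieldType) (a b c d e f : C) :
  c * c^* <= 1 -> d * d^* <= 1 ->
  (1 + c * c^*) * (1 + d * d^*) <= permanent_entries a b c d e f.
Proof.
(* Exchange the indices 1 and 2. *)
have -> : permanent_entries a b c d e f = permanent_entries c d a b e f^*.
  by rewrite /permanent_entries !(rmorphD, rmorphM) /= ?conjCK; ring.
exact: permanent_entries_ge_matching01_23.
Qed.

Lemma permanent_entries_ge_matching03_12 (C : numClosedFieldType) (a b c d e f : C) :
  e * e^* <= 1 -> f * f^* <= 1 ->
  (1 + e * e^*) * (1 + f * f^*) <= permanent_entries a b c d e f.
Proof.
(* Exchange the indices 1 and 3. *)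
have -> : permanent_entries a b c d e f = permanent_entries e f^* c d^* a b^*.
  by rewrite /permanent_entries !(rmorphD, rmorphM) /= ?conjCK; ring.
have := @permanent_entries_ge_matching01_23 _ e f^* c d^* a b^*.
by rewrite conjCK [f^* * f]mulrC.
Qed.

(** Here t x y z is the principal minor of a triple of indices. The four minors
    bound the 3-cycle terms below. For the 4-cycles, each of the three double
    products satisfies - 2 Re (u conj v) <= |u|^2 + |v|^2, where |u|^2 and |v|^2
    are products over two matchings; the sum of these bounds is twice the double
    transposition terms. *)
Lemma permanent_entries_ge_triangles (C : numClosedFieldType) (a b c d e f : C) :
  let t x y z := 1 + (x * y * z^* + x^* * y^* * z) - x * x^* - y * y^* - z * z^* in
  0 <= t a f c -> 0 <= t a d e -> 0 <= t c b e -> 0 <= t f b d ->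
  (a * a^* + b * b^* + (c * c^* + d * d^*) + (e * e^* + f * f^*)) *+ 3 - 3
  - (a * a^* * (b * b^*) + c * c^* * (d * d^*) + e * e^* * (f * f^*))
  <= permanent_entries a b c d e f.
Proof.
move=> t h1 h2 h3 h4; rewrite -subr_ge0 [X in 0 <= X](_ : _ =
  (t a f c + t a d e + t c b e + t f b d)
  + (c * d + e * f) * (c * d + e * f)^*
  + (a * b + e * f^*) * (a * b + e * f^*)^*
  + (a * b^* + c * d^*) * (a * b^* + c * d^*)^*); last first.
  by rewrite /permanent_entries /t !(rmorphD, rmorphM) /= ?conjCK; ring.
by repeat first [assumption | exact: mul_conjC_ge0 | apply: addr_ge0].
Qed.

(** * The inequality between squared moduli *)

(** The permanent of the symmetric matrix with unit diagonal and off-diagonal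
    entries a, ..., f placed as in permanent_entries. *)
Definition modulus_permanent (K : comNzRingType) (a b c d e f : K) : K :=
  1 + (a ^+ 2 + b ^+ 2 + c ^+ 2 + d ^+ 2 + e ^+ 2 + f ^+ 2)
  + (a * b + c * d + e * f) ^+ 2
  + (a * c * f + a * d * e + b * c * e + b * d * f) *+ 2.

(** Here and in minors_bound_suffices, p_i stands for the sum of the two entries
    of a matching, r_i for their product, and T for the sum of the products over
    the four triangles, each of which has one edge in every matching. After
    expanding, the terms in r are harmless and what has to hold is
    2 p1 >= p2^2 + p3^2 + 2 p1 p2 p3; with q = p2 + p3 this follows from
    p2^2 + p3^2 <= p1 q and p2 p3 <= q^2 / 4 as long as q + q^2 / 2 <= 2, that is
    q <= sqrt 5 - 1, which is slightly more than 6/5. *)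
Lemma matching_bound_suffices (R : realFieldType) (p1 p2 p3 r1 r2 r3 T P : R) :
  0 <= p2 -> 0 <= p3 -> p2 <= p1 -> p3 <= p1 -> p2 + p3 <= 6/5 ->
  0 <= r1 -> r1 <= 1 -> 0 <= r2 -> 0 <= r3 ->
  r2 *+4 <= p2^+2 -> r3*+4 <= p3^+2 ->
  T <= p1 * p2 * p3 -> 1 + p1 + r1 <= P ->
  1 + (p1^+2+p2^+2+p3^+2) - (r1+r2+r3) *+ 2 + (r1+r2+r3)^+2 + T*+2 <= P^+2.
Proof.
move=> p2g p3g h21 h31 q r1g r1l r2g r3g h2 h4 hT hP.
have h : (1 + p1 + r1)^+2 <= P^+2 by rewrite ler_sqr ?nnegrE; lra.
apply: le_trans h.
have hq : (p2 + p3) ^+ 2 <= 36/25.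
  by rewrite expr2; have := ler_pM (addr_ge0 p2g p3g) (addr_ge0 p2g p3g) q q; lra.
have hm : p2 * p3 <= 9/25 by have := sqr_ge0 (p2 - p3); lra.
have hr : r2 + r3 <= 9/25 by have := mulr_ge0 p2g p3g; lra.
have h5 : p2^+2 + p3^+2 <= p1 * (p2+p3) by nra.
have h6 : p1 * (p2 * p3) <= p1 * (9/25) by nra.
have h7 : p1 * (p2+p3) <= p1 * (6/5) by nra.
have h8 : r1 * (r2+r3) <= r1 * (9/25) by nra.
have h9 : 0 <= p1 * r1 by nra.
have h10 : (r2 + r3)^+2 <= r2 + r3 by nra.
nra.
Qed.

(** The squares of rho = r1 + r2 + r3 cancel between the two sides, which leaves
    an inequality linear in rho, where rho can be replaced by its upper bound
    (p1^2 + p2^2 + p3^2) / 4. Since p2 + p3 lies between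
    p1 / 2 and 2 p1, this sum of squares is at most 5/9 of the square of
    S = p1 + p2 + p3, and a cubic inequality in S on [9/5, 6] remains. *)
Lemma minors_bound_suffices (R : realFieldType) (p1 p2 p3 r1 r2 r3 T P : R) :
  0 <= p2 -> 0 <= p3 -> p2 <= p1 -> p3 <= p1 -> p1 <= 2 -> 6/5 <= p2 + p3 ->
  r1 *+ 4 <= p1^+2 ->  r2 *+4 <= p2^+2 -> r3*+4 <= p3^+2 ->
  T <= p1 * p2 * p3 -> (p1+p2+p3) *+ 3 - 3 - (r1+r2+r3) <= P ->
  1 + (p1^+2+p2^+2+p3^+2) - (r1+r2+r3) *+ 2 + (r1+r2+r3)^+2 + T*+2 <= P^+2.
Proof.
move=> p2g p3g h21 h31 p1l q h1 h2 h4 hT hP.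
set rho := r1 + r2 + r3 in hP *.
have hrho : rho *+ 4 <= p1^+2+p2^+2+p3^+2 by rewrite /rho; lra.
have h : ((p1+p2+p3) *+ 3 - 3 - rho)^+2 <= P^+2.
  rewrite ler_sqr ?nnegrE //; first nra.
  apply: le_trans hP; nra.
apply: le_trans h.
have hsq : p1^+2+p2^+2+p3^+2 <= 5/9 * (p1+p2+p3)^+2 - (p2 * p3) *+ 2.
  have : 0 <= (p1 *+ 2 - (p2+p3)) * ((p2+p3) *+ 2 - p1) by apply: mulr_ge0; lra.
  lra.
set S := p1 + p2 + p3 in hsq hP *.
have S1 : 9/5 <= S by rewrite /S; lra.
have S2 : S <= 6 by rewrite /S; lra.
have key : 1 + (S * (3/2) - 1) * (5/9 * S ^+ 2) <= 9 * (S - 1)^+2.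
  (* Eighteen times the difference is 15 S (S - 9/5) (6 - S) plus a quadratic
     polynomial without real roots, minimal at S = 81/55. *)
  have hc : 0 <= S * ((S - 9/5) * (6 - S)) by apply: mulr_ge0; [|apply: mulr_ge0]; lra.
  have hs : 0 <= (S - 81/55)^+2 by apply: sqr_ge0.
  lra.
have h5 : (S * 6 - 8) * rho <= (S * 6 - 8) * ((p1^+2+p2^+2+p3^+2) / 4) by apply: ler_wpM2l; lra.
have h6 : (S * (3/2) - 1) * (p1^+2+p2^+2+p3^+2) <= (S * (3/2) - 1) * (5/9 * S ^+ 2 - (p2 * p3) *+ 2) by apply: ler_wpM2l; lra.
have h7 : p1 * (p2 * p3) <= (S * (3/2) - 1) * (p2 * p3).
  apply: ler_wpM2r; first by apply: mulr_ge0; lra.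
  by rewrite /S; lra.
lra.
Qed.

Lemma modulus_permanent_le_max_first (R : realFieldType) (a b c d e f P : R) :
  0 <= a <= 1 -> 0 <= b <= 1 -> 0 <= c -> 0 <= d -> 0 <= e -> 0 <= f ->
  c + d <= a + b -> e + f <= a + b ->
  (1 + a) * (1 + b) <= P ->
  (a + b + (c + d) + (e + f)) *+ 3 - 3 - (a * b + c * d + e * f) <= P ->
  modulus_permanent a b c d e f <= P ^+ 2.
Proof.
move=> /andP[a0 a1] /andP[b0 b1] c0 d0 e0 f0 h21 h31 hA hL.
set p1 := a + b in h21 h31 hL *; set p2 := c + d in h21 hL *; set p3 := e + f in h31 hL *.
set T := a * c * f + a * d * e + b * c * e + b * d * f.
have hT : T <= p1 * p2 * p3.
  rewrite -subr_ge0.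
  have -> : p1 * p2 * p3 - T = a * c * e + a * d * f + b * c * f + b * d * e.
    by rewrite /p1 /p2 /p3 /T; ring.
  by rewrite !addr_ge0 // !mulr_ge0.
have sq x y : x * y *+ 4 <= (x + y) ^+ 2 :> R by have := sqr_ge0 (x - y); lra.
have p2_ge0 : 0 <= p2 by apply: addr_ge0.
have p3_ge0 : 0 <= p3 by apply: addr_ge0.
have -> : modulus_permanent a b c d e f =
    1 + (p1^+2+p2^+2+p3^+2) - (a * b + c * d + e * f) *+ 2
    + (a * b + c * d + e * f)^+2 + T*+2.
  by rewrite /modulus_permanent /T /p1 /p2 /p3; ring.
have [q | q] := lerP (p2 + p3) (6/5).
  apply: matching_bound_suffices => //; try exact: mulr_ge0; try exact: sq.
    by rewrite mulr_ile1.
  by move: hA; rewrite /p1; lra.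
apply: minors_bound_suffices => //; try exact: sq; rewrite /p1; lra.
Qed.

Lemma modulus_permanent_le (R : realFieldType) (a b c d e f P : R) :
  0 <= a <= 1 -> 0 <= b <= 1 -> 0 <= c <= 1 -> 0 <= d <= 1 -> 0 <= e <= 1 -> 0 <= f <= 1 ->
  (1 + a) * (1 + b) <= P -> (1 + c) * (1 + d) <= P -> (1 + e) * (1 + f) <= P ->
  (a + b + (c + d) + (e + f)) *+ 3 - 3 - (a * b + c * d + e * f) <= P ->
  modulus_permanent a b c d e f <= P ^+ 2.
Proof.
move=> ha hb hc hd he hf h1 h2 h3 hL.
case/andP: (ha) => a0 _; case/andP: (hb) => b0 _; case/andP: (hc) => c0 _.
case/andP: (hd) => d0 _; case/andP: (he) => e0 _; case/andP: (hf) => f0 _.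
have symc : modulus_permanent a b c d e f = modulus_permanent c d a b e f.
  by rewrite /modulus_permanent; ring.
have syme : modulus_permanent a b c d e f = modulus_permanent e f c d a b.
  by rewrite /modulus_permanent; ring.
have [h21|h12] := lerP (c + d) (a + b).
  have [h31|h13] := lerP (e + f) (a + b).
    exact: modulus_permanent_le_max_first.
  by rewrite syme; apply: modulus_permanent_le_max_first => //; lra.
have [h32|h23] := lerP (e + f) (c + d).
  by rewrite symc; apply: modulus_permanent_le_max_first => //; lra.
by rewrite syme; apply: modulus_permanent_le_max_first => //; lra.
Qed.

(** * The permanent of the Hadamard product *)

Local Open Scope complex_scope.

(** The order on R[i] compares real elements as R does. *)
Lemma modulus_permanent_le_complex (R : rcfType) (a b c d e f P : R[i]) :
  0 <= a <= 1 -> 0 <= b <= 1 -> 0 <= c <= 1 ->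
  0 <= d <= 1 -> 0 <= e <= 1 -> 0 <= f <= 1 ->
  (1 + a) * (1 + b) <= P -> (1 + c) * (1 + d) <= P -> (1 + e) * (1 + f) <= P ->
  (a + b + (c + d) + (e + f)) *+ 3 - 3 - (a * b + c * d + e * f) <= P ->
  modulus_permanent a b c d e f <= P ^+ 2.
Proof.
have lift (z : R[i]) : 0 <= z -> exists x : R, z = x%:C.
  by move=> z0; apply/complex_realP; apply: ger0_real.
have unit_lift (z : R[i]) : 0 <= z <= 1 -> exists2 x : R, z = x%:C & 0 <= x <= 1.
  move=> /andP[z0 z1]; have [x zE] := lift z z0; exists x => //.
  by move: z0 z1; rewrite zE -(rmorph1 (real_complex R)) -(rmorph0 (real_complex R)) !lecR => -> ->.
move=> /unit_lift[{}a -> ha] /unit_lift[{}b -> hb] /unit_lift[{}c -> hc].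
move=> /unit_lift[{}d -> hd] /unit_lift[{}e -> he] /unit_lift[{}f -> hf].
have rE := (rmorphD (real_complex R), rmorphN (real_complex R),
  rmorphM (real_complex R), rmorphMn (real_complex R),
  rmorphXn (real_complex R), rmorph1 (real_complex R),
  rmorph_nat (real_complex R)).
move=> h1; have [p pE] : exists p : R, P = p%:C.
  apply: lift; apply: le_trans h1.
  case/andP: ha hb => a0 _ /andP[b0 _].
  by rewrite mulr_ge0 // addr_ge0 // lecR.
move: h1; rewrite {}pE => h1 h2 h3 hL.
have -> : modulus_permanent a%:C b%:C c%:C d%:C e%:C f%:C = (modulus_permanent a b c d e f)%:C.
  by rewrite /modulus_permanent !rE.
rewrite -rmorphXn /= lecR; by apply: modulus_permanent_le => //; rewrite -lecR !rE.
Qed.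

Local Close Scope complex_scope.

Lemma permanent_entries_real (C : numClosedFieldType) (a b c d e f : C) :
  a^* = a -> b^* = b -> c^* = c -> d^* = d -> e^* = e -> f^* = f ->
  permanent_entries a b c d e f = modulus_permanent a b c d e f.
Proof.
move=> ha hb hc hd he hf.
by rewrite /permanent_entries /modulus_permanent !rmorphM /= !(ha, hb, hc, hd, he, hf); ring.
Qed.

Lemma permanent_hadamard_conj_le_correlation (R : rcfType) (A : 'M[R[i]]_4) :
  psdmx A -> (forall i, A i i = 1) ->
  permanent (hadamard A (entrywise_conj A)) <= permanent A ^+ 2.
Proof.
move=> hA A1.
have Ac i j : A i j = Num.conj (A j i) by case: hA => /hermsymmxE.
have sqC (z : R[i]) : Num.conj (z * Num.conj z) = z * Num.conj z.
  by rewrite rmorphM /= conjCK mulrC.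
rewrite (permanent_correlation4 Ac A1) permanent_correlation4.
- rewrite permanent_entries_real !mxE //.
  have unit01 i j : 0 <= A i j * Num.conj (A i j) <= 1.
    by rewrite mul_conjC_ge0 correlation_sqnorm_le1.
  apply: modulus_permanent_le_complex => //.
  + by apply: permanent_entries_ge_matching01_23; apply: correlation_sqnorm_le1.
  + by apply: permanent_entries_ge_matching02_13; apply: correlation_sqnorm_le1.
  + by apply: permanent_entries_ge_matching03_12; apply: correlation_sqnorm_le1.
  + by apply: permanent_entries_ge_triangles; apply: correlation_minor3_ge0.
- by move=> i j; rewrite !mxE (Ac i j) conjCK sqC mulrC.
- by move=> i; rewrite !mxE A1 rmorph1 mulr1.
Qed.

Lemma hadamard_conj_scale (C : numClosedFieldType) (n : nat) (r : 'I_n -> C) (B : 'M[C]_n) :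
  (forall i, (r i)^* = r i) ->
  let A := \matrix_(i, j) (r i * B i j * r j) in
  hadamard A (entrywise_conj A) =
  \matrix_(i, j) (r i ^+ 2 * hadamard B (entrywise_conj B) i j * r j ^+ 2).
Proof.
by move=> rC A; apply/matrixP => i j; rewrite !mxE !rmorphM /= !rC; ring.
Qed.

Theorem theorem1p1 (R : realType) (A : 'M[R[i]]_4) (hA : psdmx A) :
  permanent (hadamard A (entrywise_conj A)) <= permanent A ^+ 2.
Proof.
have [/existsP[i /eqP Ai0] | /existsPn Ann0] := boolP [exists i, A i i == 0].
  have zero := psdmx_zero_row hA Ai0.
  rewrite !(permanent_zero_row (i := i)) ?expr0n // => j.
  by rewrite mxE zero mul0r.
have Age0 i : 0 <= A i i.
  by have := psdmx_form3 i i i 1 0 0 hA; rewrite rmorph1 rmorph0; congr (0 <= _); ring.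
pose r i := sqrtC (A i i).
have r0 i : r i != 0 by rewrite sqrtC_eq0.
have rC i : Num.conj (r i) = r i by apply: conj_Creal; rewrite ger0_real // sqrtC_ge0.
pose B := \matrix_(i, j) ((r i)^-1 * A i j * (r j)^-1).
have hB : psdmx B by apply: psdmx_scale => // i; rewrite fmorphV /= rC.
have B1 i : B i i = 1.
  by rewrite mxE -[A i i]sqrtCK -/(r i); field; apply: r0.
have AE : A = \matrix_(i, j) (r i * B i j * r j).
  by apply/matrixP => i j; rewrite !mxE; field; rewrite !r0.
clearbody B; rewrite AE hadamard_conj_scale // !permanent_scale !prodrXl.
set k := \prod_i r i.
have k0 : 0 <= k by apply: prodr_ge0 => i _; rewrite sqrtC_ge0.
have -> : (k * k * permanent B) ^+ 2 = k ^+ 2 * k ^+ 2 * permanent B ^+ 2 by ring.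
apply: ler_wpM2l; first by rewrite mulr_ge0 ?exprn_ge0.
exact: permanent_hadamard_conj_le_correlation.
Qed.
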